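(* Let $\mathcal{C}$ be a regular Goursat category and let $\mathcal{X}$ be a (regular epi)-reflective subcategory of $\mathcal{C}$, with full inclusion $U\colon\mathcal{X}\to\mathcal{C}$ and reflector (left adjoint of $U$) $I\colon\mathcal{C}\to\mathcal{X}$. Given any extension (that is, regular epimorphism) $f\colon A\to B$ in $\mathcal{C}$, the internal Galois pregroupoid $\mathsf{Gal}(f)$ is an internal groupoid in $\mathcal{X}$.
   Context: A regular category $\mathcal{C}$ is called a Goursat category when $RSR=SRS$ for any two (effective) equivalence relations $R$ and $S$ on the same object of $\mathcal{C}$, where juxtaposition denotes the composition of relations and an equivalence relation is effective when it is the kernel pair of some morphism. A full reflective subcategory $\mathcal{X}$ of $\mathcal{C}$ is (regular epi)-reflective when each component $\eta_X\colon X\to UI(X)$ of the unit of the adjunction $I\dashv U$ is a regular epimorphism in $\mathcal{C}$. An internal precategory in a category consists of objects $P_0,P_1,P_2$ and morphisms $p_1,p_2,m\colon P_2\to P_1$, $d_1,d_2\colon P_1\to P_0$, $s\colon P_0\to P_1$ such that: (1) $d_1s=1_{P_0}=d_2s$; (2) $d_2p_1=d_1p_2$; (3) $d_1p_1=d_1m$ and $d_2p_2=d_2m$. It is an internal groupoid when these data are those of an internal groupoid in the usual sense: the square $d_2p_1=d_1p_2$ is a pullback (so that $P_2$ is the object of composable pairs), the composition $m$ is associative and unital with units given by $s$, and every arrow is invertible (there is an inversion morphism $P_1\to P_1$). Let $f\colon A\to B$ be a regular epimorphism in $\mathcal{C}$, and let $\mathrm{Eq}(f)$ denote its kernel pair,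 with projections $d_1,d_2\colon\mathrm{Eq}(f)\to A$. This is an equivalence relation, hence an internal groupoid in $\mathcal{C}$, with $P_0=A$, $P_1=\mathrm{Eq}(f)$, $P_2=\mathrm{Eq}(f)\times_A\mathrm{Eq}(f)$ the pullback of $d_2$ and $d_1$ with projections $p_1,p_2$ (so $d_2p_1=d_1p_2$), $s\colon A\to\mathrm{Eq}(f)$ the diagonal (reflexivity) and $m\colon\mathrm{Eq}(f)\times_A\mathrm{Eq}(f)\to\mathrm{Eq}(f)$ the transitivity morphism. The internal Galois pregroupoid $\mathsf{Gal}(f)$ of $f$ is the internal precategory in $\mathcal{X}$ obtained by applying $I$ to these data, i.e. with objects $I(A)$, $I(\mathrm{Eq}(f))$, $I(\mathrm{Eq}(f)\times_A\mathrm{Eq}(f))$ and morphisms $I(p_1),I(p_2),I(m),I(d_1),I(d_2),I(s)$. *)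

(* Defs.v *)
Set Implicit Arguments.
Unset Strict Implicit.
Unset Printing Implicit Defensive.

Declare Scope cat_scope.
Delimit Scope cat_scope with cat.
Open Scope cat_scope.

Record Category := {
  Ob :> Type;
  Hom : Ob -> Ob -> Type;
  idm : forall A, Hom A A;
  comp : forall A B D, Hom B D -> Hom A B -> Hom A D;
  comp_idl : forall A B (f : Hom A B), comp (idm B) f = f;
  comp_idr : forall A B (f : Hom A B), comp f (idm A) = f;
  comp_assoc : forall A B D E (h : Hom D E) (g : Hom B D) (f : Hom A B),
    comp h (comp g f) = comp (comp h g) f
}.
Arguments Hom {c} A B.
Arguments idm {c} A.

Notation "g \o f" := (comp g f)
  (at level 40, left associativity, format "g  \o  f") : cat_scope.

Record Functor (C D : Category) := {
  fob :> C -> D;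
  fmap : forall A B, Hom A B -> Hom (fob A) (fob B);
  fmap_id : forall A, fmap (idm A) = idm (fob A);
  fmap_comp : forall A B E (g : Hom B E) (f : Hom A B),
    fmap (g \o f) = fmap g \o fmap f
}.
Arguments fmap {C D} F {A B} f : rename.

(* Unit-counit form of the adjunction [L -| R]. *)
Record Adjunction (C D : Category) (L : Functor C D) (R : Functor D C) := {
  adj_unit : forall A : C, Hom A (R (L A));
  adj_counit : forall Y : D, Hom (L (R Y)) Y;
  adj_unit_natural : forall (A B : C) (f : Hom A B),
    adj_unit B \o f = fmap R (fmap L f) \o adj_unit A;
  adj_counit_natural : forall (Y Z : D) (g : Hom Y Z),
    adj_counit Z \o fmap L (fmap R g) = g \o adj_counit Y;
  triangle_left : forall A : C, adj_counit (L A) \o fmap L (adj_unit A) = idm (L A);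
  triangle_right : forall Y : D, fmap R (adj_counit Y) \o adj_unit (R Y) = idm (R Y)
}.
Arguments adj_unit {C D L R} a A : rename.
Arguments adj_counit {C D L R} a Y : rename.

Definition full_subcategory (C : Category) (X : C -> Prop) : Category := {|
  Ob := {A : C | X A};
  Hom := fun A B => Hom (proj1_sig A) (proj1_sig B);
  idm := fun A => idm (proj1_sig A);
  comp := fun A B D g f => g \o f;
  comp_idl := fun A B f => comp_idl f;
  comp_idr := fun A B f => comp_idr f;
  comp_assoc := fun A B D E h g f => comp_assoc h g f
|}.

Definition full_inclusion (C : Category) (X : C -> Prop) :
    Functor (full_subcategory X) C :=
  @Build_Functor (full_subcategory X) C
    (fun A => proj1_sig A) (fun A B f => f)
    (fun A => eq_refl) (fun A B E g f => eq_refl).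

Section Limits.
Variable C : Category.

Definition is_terminal (T : C) : Prop :=
  forall A : C, exists! h : Hom A T, True.

Definition is_pullback (A B D P : C) (f : Hom A D) (g : Hom B D)
    (p : Hom P A) (q : Hom P B) : Prop :=
  f \o p = g \o q /\
  forall (Z : C) (u : Hom Z A) (v : Hom Z B), f \o u = g \o v ->
    exists! h : Hom Z P, p \o h = u /\ q \o h = v.

Definition is_kernel_pair (A B K : C) (f : Hom A B) (k1 k2 : Hom K A) : Prop :=
  is_pullback f f k1 k2.

Definition is_coequalizer (K A Q : C) (u v : Hom K A) (q : Hom A Q) : Prop :=
  q \o u = q \o v /\
  forall (Z : C) (g : Hom A Z), g \o u = g \o v ->
    exists! h : Hom Q Z, h \o q = g.

Definition is_regular_epi (A B : C) (f : Hom A B) : Prop :=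
  exists (K : C) (u v : Hom K A), is_coequalizer u v f.

End Limits.

Record is_regular (C : Category) : Prop := {
  has_terminal : exists T : C, is_terminal T;
  has_pullbacks : forall (A B D : C) (f : Hom A D) (g : Hom B D),
    exists (P : C) (p : Hom P A) (q : Hom P B), is_pullback f g p q;
  has_kernel_pair_coequalizers :
    forall (A B K : C) (f : Hom A B) (k1 k2 : Hom K A),
    is_kernel_pair f k1 k2 ->
    exists (Q : C) (q : Hom A Q), is_coequalizer k1 k2 q;
  regular_epi_stable :
    forall (A B D P : C) (f : Hom A D) (g : Hom B D)
      (p : Hom P A) (q : Hom P B),
    is_pullback f g p q -> is_regular_epi f -> is_regular_epi q
}.

(* A jointly monic span, i.e. a mono into the product of [X] and [Y]. *)
Record Relation (C : Category) (X Y : C) := {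
  rel_ob : C;
  rel_1 : Hom rel_ob X;
  rel_2 : Hom rel_ob Y;
  rel_jointly_monic : forall (Z : C) (u v : Hom Z rel_ob),
    rel_1 \o u = rel_1 \o v -> rel_2 \o u = rel_2 \o v -> u = v
}.

Section Relations.
Variable C : Category.

Definition related (X Y : C) (R : Relation X Y) (Z : C)
    (x : Hom Z X) (y : Hom Z Y) : Prop :=
  exists h : Hom Z (rel_ob R), rel_1 R \o h = x /\ rel_2 R \o h = y.

Definition is_equivalence_relation (X : C) (R : Relation X X) : Prop :=
  forall Z : C,
    (forall x : Hom Z X, related R x x) /\
    (forall x y : Hom Z X, related R x y -> related R y x) /\
    (forall x y z : Hom Z X, related R x y -> related R y z -> related R x z).

Definition is_effective (X : C) (R : Relation X X) : Prop :=
  exists (Y : C) (f : Hom X Y), is_kernel_pair f (rel_1 R) (rel_2 R).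

(* [T] is the relation "[R], then [S]": the (regular epi, mono)-image in the
   product of [X] and [Z] of the pullback of [R] and [S] over [Y]. In a regular
   category such a [T] exists and is unique up to [rel_eq]. *)
Definition is_composite (X Y Z : C) (R : Relation X Y) (S : Relation Y Z)
    (T : Relation X Z) : Prop :=
  exists (P : C) (p : Hom P (rel_ob R)) (q : Hom P (rel_ob S))
      (e : Hom P (rel_ob T)),
    is_pullback (rel_2 R) (rel_1 S) p q /\
    is_regular_epi e /\
    rel_1 T \o e = rel_1 R \o p /\
    rel_2 T \o e = rel_2 S \o q.

Definition is_triple_composite (W X Y Z : C) (R : Relation W X)
    (S : Relation X Y) (R' : Relation Y Z) (T : Relation W Z) : Prop :=
  exists Q : Relation W Y, is_composite R S Q /\ is_composite Q R' T.

Definition rel_le (X Y : C) (R S : Relation X Y) : Prop :=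
  exists j : Hom (rel_ob R) (rel_ob S),
    rel_1 S \o j = rel_1 R /\ rel_2 S \o j = rel_2 R.

(* Equality as subobjects of the product of [X] and [Y]. *)
Definition rel_eq (X Y : C) (R S : Relation X Y) : Prop :=
  rel_le R S /\ rel_le S R.

End Relations.

Definition is_goursat (C : Category) : Prop :=
  is_regular C /\
  forall (X : C) (R S : Relation X X),
    is_equivalence_relation R -> is_effective R ->
    is_equivalence_relation S -> is_effective S ->
    forall RSR SRS : Relation X X,
      is_triple_composite R S R RSR -> is_triple_composite S R S SRS ->
      rel_eq RSR SRS.

Definition is_regular_epi_reflective (C : Category) (X : C -> Prop)
    (I : Functor C (full_subcategory X))
    (adj : Adjunction I (full_inclusion X)) : Prop :=
  forall A : C, is_regular_epi (adj_unit adj A).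

Record Precategory (C : Category) := {
  P0 : C;
  P1 : C;
  P2 : C;
  pc_p1 : Hom P2 P1;
  pc_p2 : Hom P2 P1;
  pc_m : Hom P2 P1;
  pc_d1 : Hom P1 P0;
  pc_d2 : Hom P1 P0;
  pc_s : Hom P0 P1;
  pc_d1s : pc_d1 \o pc_s = idm P0;
  pc_d2s : pc_d2 \o pc_s = idm P0;
  pc_d2p1 : pc_d2 \o pc_p1 = pc_d1 \o pc_p2;
  pc_d1m : pc_d1 \o pc_p1 = pc_d1 \o pc_m;
  pc_d2m : pc_d2 \o pc_p2 = pc_d2 \o pc_m
}.

Lemma fmap_square (C D : Category) (F : Functor C D) (A B B' E : C)
    (f : Hom B E) (u : Hom A B) (g : Hom B' E) (v : Hom A B') :
  f \o u = g \o v -> fmap F f \o fmap F u = fmap F g \o fmap F v.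
Proof. intro H. rewrite <- !fmap_comp, H. reflexivity. Qed.

Lemma fmap_retract (C D : Category) (F : Functor C D) (A B : C)
    (f : Hom B A) (u : Hom A B) :
  f \o u = idm A -> fmap F f \o fmap F u = idm (F A).
Proof. intro H. rewrite <- fmap_comp, H. apply fmap_id. Qed.

Definition map_precategory (C D : Category) (F : Functor C D)
    (P : Precategory C) : Precategory D := {|
  P0 := F (P0 P);
  P1 := F (P1 P);
  P2 := F (P2 P);
  pc_p1 := fmap F (pc_p1 P);
  pc_p2 := fmap F (pc_p2 P);
  pc_m := fmap F (pc_m P);
  pc_d1 := fmap F (pc_d1 P);
  pc_d2 := fmap F (pc_d2 P);
  pc_s := fmap F (pc_s P);
  pc_d1s := fmap_retract F (pc_d1s P);
  pc_d2s := fmap_retract F (pc_d2s P);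
  pc_d2p1 := fmap_square F (pc_d2p1 P);
  pc_d1m := fmap_square F (pc_d1m P);
  pc_d2m := fmap_square F (pc_d2m P)
|}.

(* On generalized elements: [w] is the composite "[u], then [v]". *)
Definition composes_to (C : Category) (P : Precategory C) (Z : C)
    (u v w : Hom Z (P1 P)) : Prop :=
  exists h : Hom Z (P2 P),
    pc_p1 P \o h = u /\ pc_p2 P \o h = v /\ pc_m P \o h = w.

(* Associativity is stated on generalized elements, so that no object of
   composable triples has to be chosen. *)
Record is_internal_groupoid (C : Category) (P : Precategory C) : Prop := {
  gpd_pullback : is_pullback (pc_d2 P) (pc_d1 P) (pc_p1 P) (pc_p2 P);
  gpd_assoc : forall (Z : C) (u v w uv vw x y : Hom Z (P1 P)),
    composes_to u v uv -> composes_to uv w x ->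
    composes_to v w vw -> composes_to u vw y -> x = y;
  gpd_unit_left :
    composes_to (pc_s P \o pc_d1 P) (idm (P1 P)) (idm (P1 P));
  gpd_unit_right :
    composes_to (idm (P1 P)) (pc_s P \o pc_d2 P) (idm (P1 P));
  gpd_inverse : exists i : Hom (P1 P) (P1 P),
    pc_d1 P \o i = pc_d2 P /\
    pc_d2 P \o i = pc_d1 P /\
    composes_to (idm (P1 P)) i (pc_s P \o pc_d1 P) /\
    composes_to i (idm (P1 P)) (pc_s P \o pc_d2 P)
}.

(* A choice of kernel pair of [f], of object of composable pairs, and of the
   (uniquely determined) reflexivity and transitivity morphisms. *)
Record KernelPairData (C : Category) (A B : C) (f : Hom A B) := {
  kp_Eq : C;
  kp_d1 : Hom kp_Eq A;
  kp_d2 : Hom kp_Eq A;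
  kp_kernel_pair : is_kernel_pair f kp_d1 kp_d2;
  kp_EqEq : C;
  kp_p1 : Hom kp_EqEq kp_Eq;
  kp_p2 : Hom kp_EqEq kp_Eq;
  kp_pullback : is_pullback kp_d2 kp_d1 kp_p1 kp_p2;
  kp_s : Hom A kp_Eq;
  kp_d1s : kp_d1 \o kp_s = idm A;
  kp_d2s : kp_d2 \o kp_s = idm A;
  kp_m : Hom kp_EqEq kp_Eq;
  kp_d1m : kp_d1 \o kp_p1 = kp_d1 \o kp_m;
  kp_d2m : kp_d2 \o kp_p2 = kp_d2 \o kp_m
}.

Definition kernel_pair_precategory (C : Category) (A B : C) (f : Hom A B)
    (K : KernelPairData f) : Precategory C := {|
  P0 := A;
  P1 := kp_Eq K;
  P2 := kp_EqEq K;
  pc_p1 := kp_p1 K;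
  pc_p2 := kp_p2 K;
  pc_m := kp_m K;
  pc_d1 := kp_d1 K;
  pc_d2 := kp_d2 K;
  pc_s := kp_s K;
  pc_d1s := kp_d1s K;
  pc_d2s := kp_d2s K;
  pc_d2p1 := proj1 (kp_pullback K);
  pc_d1m := kp_d1m K;
  pc_d2m := kp_d2m K
|}.

Definition Gal (C D : Category) (I : Functor C D) (A B : C) (f : Hom A B)
    (K : KernelPairData f) : Precategory D :=
  map_precategory I (kernel_pair_precategory K).

(* Main.v *)
Require Import Defs.
From Stdlib Require Import Setoid.
Set Implicit Arguments.
Unset Strict Implicit.

(** Write [T] for the composite of the reflector with the inclusion. The unit
    is a natural transformation from the identity to [T] whose components are
    regular epimorphisms, and every such [T] sends the groupoid [Eq(f)] to a
    groupoid of [C] ([quotient_of_kernel_pair_groupoid]). The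
    inclusion is full, so it reflects internal groupoids.

    Degeneracies, inversion and their equations survive any functor. What has
    to be proved is that the image of the object of composable pairs is again
    an object of composable pairs, and that the new composition is associative.
    The arguments use generalized elements; an element of a quotient can be
    lifted after passing to a regular epimorphic cover of its domain. An arrow
    of [Eq(f)] is a pair (a,b) and a composable pair is a triple (a,b,c) of
    elements with the same image under [f]. Write ~ for equality after the
    unit.

    Uniqueness of composable pairs ([quotient_pair_jointly_monic]): from
    (a,b) ~ (a',b') and (b,c) ~ (b',c') one must deduce (a,b,c) ~ (a',b',c').
    This follows by applying the Shifting Lemma twice, starting from degenerate
    triples, which satisfy the implication by naturality.

    Existence of composable pairs ([quotient_pair_exists]): the Goursat property
    implies that two elements of a quotient identified by a split epimorphism
    lift, up to a cover, to elements already identified upstairs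
    ([goursat_kernel_lift]). With the inversion, a composable pair is a pair of
    arrows with a common codomain, to which this applies.

    Associativity ([quotient_associative]): composable triples are pairs of
    2-simplices with a common face, so the same lifting principle, applied to
    [p1] instead of [d2], lifts them to quadruples (a,b,c,d), where both ways of
    composing give (a,d). *)

(** * Generalized elements *)

Lemma comp_eq_at (C : Category) (A B B' D Z : C) (g : Hom B D) (f : Hom A B)
    (g' : Hom B' D) (f' : Hom A B') (z : Hom Z A) :
  g \o f = g' \o f' -> g \o (f \o z) = g' \o (f' \o z).
Proof. intro E. rewrite !comp_assoc, E. reflexivity. Qed.

Lemma comp_eq1_at (C : Category) (A B D Z : C) (g : Hom B D) (f : Hom A B)
    (k : Hom A D) (z : Hom Z A) :
  g \o f = k -> g \o (f \o z) = k \o z.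
Proof. intro E. rewrite comp_assoc, E. reflexivity. Qed.

Lemma retract_at (C : Category) (A B Z : C) (g : Hom B A) (f : Hom A B)
    (z : Hom Z A) :
  g \o f = idm A -> g \o (f \o z) = z.
Proof. intro E. rewrite comp_assoc, E. apply comp_idl. Qed.

Lemma pullback_lift (C : Category) (A B D P : C) (f : Hom A D) (g : Hom B D)
    (p : Hom P A) (q : Hom P B) (Z : C) (u : Hom Z A) (v : Hom Z B) :
  is_pullback f g p q -> f \o u = g \o v ->
  exists h : Hom Z P, p \o h = u /\ q \o h = v.
Proof. intros [_ H] E. destruct (H Z u v E) as [h [Hh _]]. exists h. exact Hh. Qed.

Lemma pullback_jointly_monic (C : Category) (A B D P : C) (f : Hom A D)
    (g : Hom B D) (p : Hom P A) (q : Hom P B) (Z : C) (u v : Hom Z P) :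
  is_pullback f g p q -> p \o u = p \o v -> q \o u = q \o v -> u = v.
Proof.
  intros [E H] Ep Eq.
  destruct (H Z (p \o u) (q \o u)) as [h [_ Hu]].
  { apply comp_eq_at, E. }
  rewrite <- (Hu u) by auto. apply Hu. auto.
Qed.

Lemma regular_epi_epi (C : Category) (A B Z : C) (e : Hom A B) (u v : Hom B Z) :
  is_regular_epi e -> u \o e = v \o e -> u = v.
Proof.
  intros (K & a & b & E & H) Euv.
  destruct (H Z (u \o e)) as [h [_ Hu]].
  { rewrite <- !comp_assoc, E. reflexivity. }
  rewrite <- (Hu u) by reflexivity. apply Hu. auto.
Qed.

Lemma regular_epi_id (C : Category) (A : C) : is_regular_epi (idm A).
Proof.
  exists A, (idm A), (idm A). split; [reflexivity|].
  intros Z g _. exists g. split; [apply comp_idr|].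
  intros h <-. apply comp_idr.
Qed.

Lemma related_precomp (C : Category) (X Y : C) (R : Relation X Y) (Z Z' : C)
    (x : Hom Z X) (y : Hom Z Y) (e : Hom Z' Z) :
  related R x y -> related R (x \o e) (y \o e).
Proof.
  intros (h & <- & <-). exists (h \o e). rewrite !comp_assoc. auto.
Qed.

(** Regular epimorphisms are orthogonal to jointly monic spans; hence whether
    two generalized elements are related may be tested on a cover. *)
Lemma related_descent (C : Category) (X Y : C) (R : Relation X Y) (Z Z' : C)
    (x : Hom Z X) (y : Hom Z Y) (e : Hom Z' Z) :
  is_regular_epi e -> related R (x \o e) (y \o e) -> related R x y.
Proof.
  intros He (h & Hx & Hy).
  pose proof He as (K & a & b & E & H).
  destruct (H _ h) as [k [Hk _]].
  { apply (rel_jointly_monic (r := R)).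
    - rewrite !comp_assoc, Hx, <- !comp_assoc, E. reflexivity.
    - rewrite !comp_assoc, Hy, <- !comp_assoc, E. reflexivity. }
  exists k. split; apply (regular_epi_epi He); rewrite <- comp_assoc, Hk; assumption.
Qed.

(** * Regular epimorphisms and relations in a regular category *)

Section Regular.
Variables (C : Category) (C_regular : is_regular C).

(** The morphism [k] is the pairing of [f] and [g] into the product of [X] and
    [Y]; only its kernel pair matters in what follows, so the projections are
    not recorded. *)
Lemma pairing_exists (A X Y : C) (f : Hom A X) (g : Hom A Y) :
  exists (W : C) (k : Hom A W), forall (Z : C) (u v : Hom Z A),
    k \o u = k \o v <-> f \o u = f \o v /\ g \o u = g \o v.
Proof.
  destruct (has_terminal C_regular) as [T HT].
  destruct (HT X) as [x _], (HT Y) as [y _].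
  destruct (has_pullbacks C_regular x y) as (W & p & q & HW).
  destruct (@pullback_lift _ _ _ _ _ _ _ _ _ _ f g HW) as (k & <- & <-).
  { destruct (HT A) as [t [_ Ht]]. rewrite <- (Ht (x \o f)), <- (Ht (y \o g)); auto. }
  exists W, k. intros Z u v. rewrite <- !comp_assoc. split.
  - intros ->. auto.
  - intros [E1 E2]. exact (pullback_jointly_monic HW E1 E2).
Qed.

Lemma lift_along_regular_epi (A B Z : C) (q : Hom A B) (z : Hom Z B) :
  is_regular_epi q ->
  exists (Z' : C) (e : Hom Z' Z) (x : Hom Z' A), is_regular_epi e /\ q \o x = z \o e.
Proof.
  intro Hq. destruct (has_pullbacks C_regular q z) as (P & x & e & HP).
  exists P, e, x. split; [exact (regular_epi_stable C_regular HP Hq) | exact (proj1 HP)].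
Qed.

(** The image is the coequalizer of the kernel pair of the pairing of [f] and
    [g]. It is jointly monic because two elements of it with the same
    coordinates lift, on a cover, to elements of [P] in that kernel pair. *)
Lemma span_image (P X Y : C) (f : Hom P X) (g : Hom P Y) :
  exists (T : Relation X Y) (e : Hom P (rel_ob T)),
    is_regular_epi e /\ rel_1 T \o e = f /\ rel_2 T \o e = g.
Proof.
  destruct (pairing_exists f g) as (W & k & Hk).
  destruct (has_pullbacks C_regular k k) as (K & k1 & k2 & HK).
  destruct (has_kernel_pair_coequalizers C_regular HK) as (Q & q & Hq).
  assert (Rq : is_regular_epi q) by (exists K, k1, k2; exact Hq).
  destruct Hq as [Eq Uq].
  destruct (proj1 (Hk _ k1 k2) (proj1 HK)) as [Ef Eg].
  destruct (Uq X f Ef) as [x [Hx _]], (Uq Y g Eg) as [y [Hy _]].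
  assert (J : forall (Z : C) (u v : Hom Z Q), x \o u = x \o v -> y \o u = y \o v -> u = v).
  { intros Z u v Exu Eyu.
    destruct (lift_along_regular_epi u Rq) as (Z1 & e1 & a & He1 & Ea).
    destruct (lift_along_regular_epi (v \o e1) Rq) as (Z2 & e2 & b & He2 & Eb).
    apply (regular_epi_epi He1), (regular_epi_epi He2).
    assert (Eab : k \o (a \o e2) = k \o b).
    { apply Hk. rewrite <- Hx, <- Hy, <- !comp_assoc, Eb, !(comp_assoc q), Ea.
      rewrite !comp_assoc, Exu, Eyu. auto. }
    destruct (pullback_lift HK Eab) as (h & E1 & E2).
    rewrite <- Eb, <- Ea, <- E2, <- comp_assoc, <- E1. apply comp_eq_at, Eq. }
  exists (Build_Relation J), q. auto.
Qed.

(** Let [m] be either leg of the image of the span formed by two copies of the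
    composite. By orthogonality to each factor in turn the identity factors
    through [m], so [m] is invertible and the composite is a coequalizer. *)
Lemma regular_epi_comp (Z Z' Z'' : C) (e : Hom Z' Z) (e' : Hom Z'' Z') :
  is_regular_epi e -> is_regular_epi e' -> is_regular_epi (e \o e').
Proof.
  intros He He'.
  destruct (span_image (e \o e') (e \o e')) as (T & q & Hq & E1 & E2).
  assert (HT : related T (idm Z) (idm Z)).
  { apply (related_descent He), (related_descent He'). exists q.
    rewrite comp_idl. auto. }
  destruct HT as (h & F1 & F2).
  assert (Hh : h \o rel_1 T = idm _).
  { apply (regular_epi_epi Hq). rewrite comp_idl.
    apply (rel_jointly_monic (r := T));
      rewrite <- comp_assoc, E1, comp_assoc, ?F1, ?F2, comp_idl; auto. }
  destruct Hq as (K & u & v & E & U). exists K, u, v. split.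
  - rewrite <- E1, <- !comp_assoc, E. reflexivity.
  - intros W g Eg. destruct (U W g Eg) as [k [Hk Uk]].
    exists (k \o h). split.
    + rewrite <- E1, <- comp_assoc, (comp_assoc h), Hh, comp_idl. exact Hk.
    + intros k' Hk'. rewrite (Uk (k' \o rel_1 T)).
      * rewrite <- comp_assoc, F1. apply comp_idr.
      * rewrite <- comp_assoc, E1. exact Hk'.
Qed.

Lemma lift_pair_along_regular_epi (A B Z : C) (q : Hom A B) (x y : Hom Z B) :
  is_regular_epi q ->
  exists (Z' : C) (e : Hom Z' Z) (u v : Hom Z' A),
    is_regular_epi e /\ q \o u = x \o e /\ q \o v = y \o e.
Proof.
  intro Hq.
  destruct (lift_along_regular_epi x Hq) as (Z1 & e1 & u & He1 & Eu).
  destruct (lift_along_regular_epi (y \o e1) Hq) as (Z2 & e2 & v & He2 & Ev).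
  exists Z2, (e1 \o e2), (u \o e2), v. repeat split.
  - apply regular_epi_comp; assumption.
  - rewrite !comp_assoc, Eu. reflexivity.
  - rewrite comp_assoc. exact Ev.
Qed.

Lemma composite_exists (X Y Z : C) (R : Relation X Y) (S : Relation Y Z) :
  exists T : Relation X Z, is_composite R S T.
Proof.
  destruct (has_pullbacks C_regular (rel_2 R) (rel_1 S)) as (P & p & q & HP).
  destruct (span_image (rel_1 R \o p) (rel_2 S \o q)) as (T & e & He & E1 & E2).
  exists T, P, p, q, e. auto.
Qed.

(** The meaning of composition of relations in the internal logic: the middle
    element exists on a cover. *)
Lemma related_composite (X Y Z : C) (R : Relation X Y) (S : Relation Y Z)
    (T : Relation X Z) (W : C) (x : Hom W X) (z : Hom W Z) :
  is_composite R S T ->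
  related T x z <->
  exists (W' : C) (e : Hom W' W) (y : Hom W' Y),
    is_regular_epi e /\ related R (x \o e) y /\ related S y (z \o e).
Proof.
  intros (P & p & q & t & HP & Ht & E1 & E2). split.
  - intros (h & <- & <-).
    destruct (lift_along_regular_epi h Ht) as (W' & e & k & He & Ek).
    exists W', e, (rel_2 R \o (p \o k)). repeat split; [exact He | |].
    + exists (p \o k). split; [|reflexivity].
      rewrite comp_assoc, <- E1, <- !comp_assoc, Ek. reflexivity.
    + exists (q \o k). split.
      * symmetry. apply comp_eq_at, (proj1 HP).
      * rewrite comp_assoc, <- E2, <- !comp_assoc, Ek. reflexivity.
  - intros (W' & e & y & He & (h & Hx & Hy) & (k & Hy' & Hz)).
    apply (related_descent He).
    destruct (@pullback_lift _ _ _ _ _ _ _ _ _ _ h k HP) as (l & <- & <-).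
    { congruence. }
    exists (t \o l). rewrite <- Hx, <- Hz, !comp_assoc, E1, E2. auto.
Qed.

Lemma related_triple_composite (W X Y Z : C) (R : Relation W X)
    (S : Relation X Y) (R' : Relation Y Z) (T : Relation W Z)
    (V : C) (w : Hom V W) (z : Hom V Z) :
  is_triple_composite R S R' T ->
  related T w z <->
  exists (V' : C) (e : Hom V' V) (x : Hom V' X) (y : Hom V' Y),
    is_regular_epi e /\
    related R (w \o e) x /\ related S x y /\ related R' y (z \o e).
Proof.
  intros (Q & HQ & HT). rewrite (related_composite w z HT). split.
  - intros (V1 & e1 & y & He1 & Hwy & Hyz).
    apply (related_composite _ _ HQ) in Hwy.
    destruct Hwy as (V2 & e2 & x & He2 & Hwx & Hxy).
    exists V2, (e1 \o e2), x, (y \o e2). rewrite !comp_assoc.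
    split; [apply regular_epi_comp; assumption|].
    split; [exact Hwx|]. split; [exact Hxy|]. apply related_precomp, Hyz.
  - intros (V1 & e & x & y & He & Hwx & Hxy & Hyz).
    exists V1, e, y. split; [exact He|]. split; [|exact Hyz].
    apply (related_composite _ _ HQ).
    exists V1, (idm V1), x. rewrite !comp_idr. split; [apply regular_epi_id|auto].
Qed.

Lemma kernel_relation_exists (X Y : C) (a : Hom X Y) :
  exists R : Relation X X,
    is_equivalence_relation R /\ is_effective R /\
    forall (Z : C) (x y : Hom Z X), related R x y <-> a \o x = a \o y.
Proof.
  destruct (has_pullbacks C_regular a a) as (K & k1 & k2 & HK).
  pose (R := Build_Relation (fun Z u v => @pullback_jointly_monic _ _ _ _ _ _ _ _ _ Z u v HK)).
  assert (HR : forall (Z : C) (x y : Hom Z X), related R x y <-> a \o x = a \o y).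
  { intros Z x y. split.
    - intros (h & <- & <-). apply comp_eq_at, (proj1 HK).
    - intro E. exact (pullback_lift HK E). }
  exists R. split; [|split; [|exact HR]].
  - intro Z. split; [|split]; intros *; rewrite !HR; congruence.
  - exists Y, a. exact HK.
Qed.

End Regular.

(** * Consequences of the Goursat property *)

Section Goursat.
Variables (C : Category) (C_goursat : is_goursat C).
Let C_regular : is_regular C := proj1 C_goursat.

(** The inclusion of [RSR] in [SRS], read on elements for the kernel pairs [R]
    of [a] and [S] of [b]. *)
Lemma goursat_swap (A B D : C) (a : Hom A B) (b : Hom A D) (Z : C)
    (x y z w : Hom Z A) :
  a \o x = a \o y -> b \o y = b \o z -> a \o z = a \o w ->
  exists (Z' : C) (e : Hom Z' Z) (u v : Hom Z' A), is_regular_epi e /\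
    b \o (x \o e) = b \o u /\ a \o u = a \o v /\ b \o v = b \o (w \o e).
Proof.
  intros Exy Eyz Ezw.
  destruct (kernel_relation_exists C_regular a) as (R & R_eqv & R_eff & HR).
  destruct (kernel_relation_exists C_regular b) as (S & S_eqv & S_eff & HS).
  destruct (composite_exists C_regular R S) as [RS H1].
  destruct (composite_exists C_regular S R) as [SR H2].
  destruct (composite_exists C_regular RS R) as [RSR H3].
  destruct (composite_exists C_regular SR S) as [SRS H4].
  assert (HRSR : is_triple_composite R S R RSR) by (exists RS; auto).
  assert (HSRS : is_triple_composite S R S SRS) by (exists SR; auto).
  assert (Hxw : related RSR x w).
  { apply (related_triple_composite C_regular x w HRSR).
    exists Z, (idm Z), y, z. rewrite !comp_idr, !HR, HS.
    split; [apply regular_epi_id|auto]. }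
  destruct (proj2 C_goursat _ _ _ R_eqv R_eff S_eqv S_eff _ _ HRSR HSRS)
    as [(j & J1 & J2) _].
  destruct Hxw as (h & Hx & Hw).
  assert (Hxw : related SRS x w).
  { exists (j \o h). rewrite !comp_assoc, J1, J2. auto. }
  apply (related_triple_composite C_regular x w HSRS) in Hxw.
  destruct Hxw as (Z' & e & u & v & He & Hxu & Huv & Hvw).
  exists Z', e, u, v. rewrite <- HR, <- !HS. auto.
Qed.

(** The Shifting Lemma for the kernel pairs of [a], [b] and [c]. One goes from
    x' to y' through x and y, alternating the kernel pair of [b] with the kernel
    pair [k] of the pairing of [a] and [c]; the Goursat property exchanges the
    two, giving x' k u b v k y'. Then [a] agrees on u and v as well, so that
    [abc] applies to them. *)
Lemma shifting_lemma (A B D E : C) (a : Hom A B) (b : Hom A D) (c : Hom A E)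
    (abc : forall (Z : C) (u v : Hom Z A),
       a \o u = a \o v -> b \o u = b \o v -> c \o u = c \o v)
    (Z : C) (x y x' y' : Hom Z A) :
  a \o x = a \o y -> a \o x' = a \o y' -> b \o x = b \o x' -> b \o y = b \o y' ->
  c \o x = c \o y -> c \o x' = c \o y'.
Proof.
  intros Axy Axy' Bx By Cxy.
  destruct (pairing_exists C_regular a c) as (W & k & Hk).
  assert (Kxy : k \o x = k \o y) by (apply Hk; auto).
  destruct (goursat_swap (eq_sym Bx) Kxy By)
    as (Z' & e & u & v & He & Kxu & Buv & Kvy).
  apply Hk in Kxu. apply Hk in Kvy.
  destruct Kxu as [Axu Cxu], Kvy as [Avy Cvy].
  apply (regular_epi_epi He). rewrite <- !comp_assoc, Cxu, <- Cvy.
  apply abc; [|exact Buv].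
  rewrite <- Axu, Avy. apply comp_eq_at, Axy'.
Qed.

(** Goursat pushouts: in a morphism of split epimorphisms that is a regular
    epimorphism on total objects, the kernel pair of [d] covers that of [d'].
    For lifts x0 and y0 of x and y one has the chain x0, s d x0, s d y0, y0,
    whose steps lie in the kernel pairs of [d], [q], [d] in this order; the
    Goursat property turns it into a chain for [q], [d], [q], whose inner
    elements are the required lifts. *)
Lemma goursat_kernel_lift (P B P' B' : C) (d : Hom P B) (s : Hom B P)
    (d' : Hom P' B') (s' : Hom B' P') (q : Hom P P') (r : Hom B B') :
  d \o s = idm B -> d' \o q = r \o d -> s' \o r = q \o s -> is_regular_epi q ->
  forall (Z : C) (x y : Hom Z P'), d' \o x = d' \o y ->
  exists (Z' : C) (e : Hom Z' Z) (u v : Hom Z' P), is_regular_epi e /\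
    q \o u = x \o e /\ q \o v = y \o e /\ d \o u = d \o v.
Proof.
  intros ds dq sr Hq Z x y Exy.
  destruct (lift_pair_along_regular_epi C_regular x y Hq)
    as (Z1 & e1 & x0 & y0 & He1 & Ex & Ey).
  assert (Hxy : q \o (s \o (d \o x0)) = q \o (s \o (d \o y0))).
  { assert (F : forall z : Hom Z1 P, q \o (s \o (d \o z)) = s' \o (d' \o (q \o z))).
    { intro z. rewrite (comp_assoc d'), dq, <- (comp_assoc r).
      symmetry. apply comp_eq_at, sr. }
    rewrite !F, Ex, Ey, !(comp_assoc d'), Exy. reflexivity. }
  destruct (fun Hx Hy => @goursat_swap _ _ _ d q Z1 x0 (s \o (d \o x0)) (s \o (d \o y0)) y0
              Hx Hxy Hy) as (Z2 & e2 & u & v & He2 & Hu & Huv & Hv).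
  { symmetry. apply retract_at, ds. }
  { apply retract_at, ds. }
  exists Z2, (e1 \o e2), u, v. split; [apply regular_epi_comp; assumption|].
  rewrite <- Hu, Hv, !comp_assoc, Ex, Ey. auto.
Qed.

(** * Quotients of the groupoid of a kernel pair *)

Section Quotient.
Variables (T : Functor C C) (eta : forall A : C, Hom A (T A)).
Hypothesis eta_natural : forall (A B : C) (f : Hom A B),
  eta B \o f = fmap T f \o eta A.
Hypothesis eta_regular_epi : forall A : C, is_regular_epi (eta A).
Variables (A B : C) (f : Hom A B) (K : KernelPairData f).

Notation P1 := (kp_Eq K).
Notation P2 := (kp_EqEq K).
Notation d1 := (kp_d1 K).
Notation d2 := (kp_d2 K).
Notation p1 := (kp_p1 K).
Notation p2 := (kp_p2 K).
Notation m := (kp_m K).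
Notation s := (kp_s K).

Lemma eta_at (X Y Z : C) (g : Hom X Y) (z : Hom Z X) :
  eta Y \o (g \o z) = fmap T g \o (eta X \o z).
Proof. apply comp_eq_at, eta_natural. Qed.

Lemma eta_congr (X Y Z : C) (g : Hom X Y) (u v : Hom Z X) :
  eta X \o u = eta X \o v -> eta Y \o (g \o u) = eta Y \o (g \o v).
Proof. intro E. rewrite !eta_at, E. reflexivity. Qed.

Lemma Eq_jointly_monic (Z : C) (u v : Hom Z P1) :
  d1 \o u = d1 \o v -> d2 \o u = d2 \o v -> u = v.
Proof. apply (pullback_jointly_monic (kp_kernel_pair K)). Qed.

(** The element (x,y,z) of the object of composable pairs, with its three
    faces (x,y), (y,z) and (x,z). *)
Lemma Eq_triple (Z : C) (x y z : Hom Z A) :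
  f \o x = f \o y -> f \o y = f \o z ->
  exists h : Hom Z P2,
    d1 \o (p1 \o h) = x /\ d2 \o (p1 \o h) = y /\
    d1 \o (p2 \o h) = y /\ d2 \o (p2 \o h) = z /\
    d1 \o (m \o h) = x /\ d2 \o (m \o h) = z.
Proof.
  intros Exy Eyz.
  destruct (pullback_lift (kp_kernel_pair K) Exy) as (u & <- & U2).
  destruct (pullback_lift (kp_kernel_pair K) Eyz) as (v & V1 & <-).
  destruct (@pullback_lift _ _ _ _ _ _ _ _ _ _ u v (kp_pullback K)) as (h & <- & <-).
  { congruence. }
  exists h. repeat split; try assumption; symmetry; apply comp_eq_at.
  - apply kp_d1m.
  - apply kp_d2m.
Qed.

Lemma f_d1_d2 (Z : C) (u : Hom Z P1) : f \o (d1 \o u) = f \o (d2 \o u).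
Proof. apply comp_eq_at, (proj1 (kp_kernel_pair K)). Qed.

Lemma d1s_at (Z : C) (x : Hom Z A) : d1 \o (s \o x) = x.
Proof. apply retract_at, kp_d1s. Qed.

Lemma d2s_at (Z : C) (x : Hom Z A) : d2 \o (s \o x) = x.
Proof. apply retract_at, kp_d2s. Qed.

Lemma d2p1_at (Z : C) (h : Hom Z P2) : d2 \o (p1 \o h) = d1 \o (p2 \o h).
Proof. apply comp_eq_at, (proj1 (kp_pullback K)). Qed.
Lemma d1m_at (Z : C) (h : Hom Z P2) : d1 \o (m \o h) = d1 \o (p1 \o h).
Proof. symmetry. apply comp_eq_at, kp_d1m. Qed.
Lemma d2m_at (Z : C) (h : Hom Z P2) : d2 \o (m \o h) = d2 \o (p2 \o h).
Proof. symmetry. apply comp_eq_at, kp_d2m. Qed.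

(** [s1] is (a,b) |-> (a,a,b) and [s2] is (a,b) |-> (a,b,b). *)
Lemma degeneracies :
  exists s1 s2 : Hom P1 P2,
    (p1 \o s1 = s \o d1 /\ p2 \o s1 = idm P1 /\ m \o s1 = idm P1) /\
    (p1 \o s2 = idm P1 /\ p2 \o s2 = s \o d2 /\ m \o s2 = idm P1).
Proof.
  pose proof (f_d1_d2 (idm P1)) as E. rewrite !comp_idr in E.
  destruct (Eq_triple (eq_refl (f \o d1)) E) as (s1 & H1).
  destruct (Eq_triple E (eq_refl (f \o d2))) as (s2 & H2).
  exists s1, s2. repeat split; apply Eq_jointly_monic;
    rewrite ?comp_idr, ?d1s_at, ?d2s_at; intuition.
Qed.

(** [i] is (a,b) |-> (b,a) and [t] is (a,b) |-> (a,b,a). *)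
Lemma inversion :
  exists i : Hom P1 P1, d1 \o i = d2 /\ d2 \o i = d1 /\ i \o i = idm P1 /\
  exists t : Hom P1 P2, p1 \o t = idm P1 /\ p2 \o t = i /\ m \o t = s \o d1.
Proof.
  pose proof (f_d1_d2 (idm P1)) as E. rewrite !comp_idr in E.
  destruct (pullback_lift (kp_kernel_pair K) (eq_sym E)) as (i & I1 & I2).
  destruct (Eq_triple E (eq_sym E)) as (t & Ht).
  exists i. split; [exact I1|]. split; [exact I2|]. split.
  - apply Eq_jointly_monic; rewrite comp_assoc, ?I1, ?I2, comp_idr; auto.
  - exists t. repeat split; apply Eq_jointly_monic;
      rewrite ?comp_idr, ?d1s_at, ?d2s_at, ?I1, ?I2; intuition.
Qed.

(** Suppose (a,b) ~ (a',b') and (b,c) ~ (b',c'). The first relation gives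
    (a,b,b) ~ (a',b',b'), and the Shifting Lemma moves this along the fibres of
    [p1] to (a,b,c) ~ (a',b',c'), provided ~ is implied by its projection along
    [p2] inside each fibre of [p1]. The proviso is the claim [fibre]: from
    (b,c) ~ (b,c') follows (b,b,c) ~ (b,b,c'), which is moved along the fibres
    of [p2] to (a,b,c) ~ (a,b,c'). *)
Lemma quotient_pair_jointly_monic (Z : C) (u v : Hom Z (T P2)) :
  fmap T p1 \o u = fmap T p1 \o v -> fmap T p2 \o u = fmap T p2 \o v -> u = v.
Proof.
  intros E1 E2.
  destruct degeneracies as (s1 & s2 & (S11 & S12 & _) & (S21 & S22 & _)).
  destruct (lift_pair_along_regular_epi C_regular u v (eta_regular_epi P2))
    as (Z' & e & u' & v' & He & Eu & Ev).
  apply (regular_epi_epi He). rewrite <- Eu, <- Ev.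
  assert (F1 : eta P1 \o (p1 \o u') = eta P1 \o (p1 \o v')).
  { rewrite !eta_at, Eu, Ev, !comp_assoc, E1. reflexivity. }
  assert (F2 : eta P1 \o (p2 \o u') = eta P1 \o (p2 \o v')).
  { rewrite !eta_at, Eu, Ev, !comp_assoc, E2. reflexivity. }
  assert (fibre : forall (W : C) (g h : Hom W P2),
    (eta P1 \o p2) \o g = (eta P1 \o p2) \o h -> p1 \o g = p1 \o h ->
    eta P2 \o g = eta P2 \o h).
  { intros W g h Ep2 Ep1. rewrite <- !comp_assoc in Ep2.
    apply (@shifting_lemma _ _ _ _ p1 p2 (eta P2)) with
      (x := s1 \o (p2 \o g)) (y := s1 \o (p2 \o h)).
    - intros V k l Ek1 Ek2.
      rewrite (pullback_jointly_monic (kp_pullback K) Ek1 Ek2). reflexivity.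
    - rewrite !(comp_eq1_at _ S11), <- !comp_assoc, <- !d2p1_at, Ep1. reflexivity.
    - exact Ep1.
    - apply retract_at, S12.
    - apply retract_at, S12.
    - apply eta_congr, Ep2. }
  apply (@shifting_lemma _ _ _ _ (eta P1 \o p2) p1 (eta P2) fibre) with
    (x := s2 \o (p1 \o u')) (y := s2 \o (p1 \o v')).
  - rewrite <- !comp_assoc, !(comp_eq1_at _ S22), <- !comp_assoc.
    do 2 apply eta_congr. exact F1.
  - rewrite <- !comp_assoc. exact F2.
  - apply retract_at, S21.
  - apply retract_at, S21.
  - apply eta_congr, F1.
Qed.

(** Inverting [v] turns the composable pair into two arrows with a common
    codomain, lying over a pair of elements identified by [d2]; these lift
    together, and the lift of [v] is inverted back. Uniqueness then lets the
    element found on a cover descend. *)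
Lemma quotient_pair_exists (Z : C) (u v : Hom Z (T P1)) :
  fmap T d2 \o u = fmap T d1 \o v ->
  exists h : Hom Z (T P2), fmap T p1 \o h = u /\ fmap T p2 \o h = v.
Proof.
  intro Euv.
  destruct inversion as (i & I1 & I2 & II & _).
  destruct (@goursat_kernel_lift _ _ _ _ d2 s (fmap T d2) (fmap T s) (eta P1) (eta A)
    (kp_d2s K) (eq_sym (eta_natural _)) (eq_sym (eta_natural _)) (eta_regular_epi P1)
    Z u (fmap T i \o v)) as (Z' & e & u' & v' & He & Eu & Ev & Ed).
  { rewrite comp_assoc, <- fmap_comp, I2. exact Euv. }
  apply (related_descent (R := Build_Relation quotient_pair_jointly_monic) He).
  destruct (@pullback_lift _ _ _ _ _ _ _ _ _ _ u' (i \o v') (kp_pullback K))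
    as (h & H1 & H2).
  { rewrite (comp_eq1_at _ I1). exact Ed. }
  exists (eta P2 \o h). simpl. rewrite <- !eta_at, H1, H2. split; [exact Eu|].
  rewrite eta_at, Ev, !comp_assoc, <- fmap_comp, II, fmap_id, comp_idl. reflexivity.
Qed.

(** Lifting requires both simplices to have their common face in the same
    position, so [h] is first rotated by (a,b,c) |-> (b,c,a), which carries its
    face [p2] to [p1], and the lift is rotated back. *)
Lemma quotient_triple_lift (Z : C) (h k : Hom Z (T P2)) :
  fmap T p2 \o h = fmap T p1 \o k ->
  exists (Z' : C) (e : Hom Z' Z) (h' k' : Hom Z' P2), is_regular_epi e /\
    eta P2 \o h' = h \o e /\ eta P2 \o k' = k \o e /\ p2 \o h' = p1 \o k'.
Proof.
  intro Ehk.
  destruct degeneracies as (_ & s2 & _ & (S21 & _ & _)).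
  assert (rotations : exists r r' : Hom P2 P2, p1 \o r = p2 /\ p2 \o r' = p1 /\ r' \o r = idm P2).
  { assert (E12 : f \o (d1 \o p1) = f \o (d2 \o p1)) by apply f_d1_d2.
    assert (E23 : f \o (d2 \o p1) = f \o (d2 \o p2)).
    { rewrite (proj1 (kp_pullback K)). apply f_d1_d2. }
    assert (E31 : f \o (d2 \o p2) = f \o (d1 \o p1)) by congruence.
    destruct (Eq_triple E23 E31) as (r & R1 & R2 & R3 & R4 & _).
    destruct (Eq_triple E31 E12) as (r' & R1' & R2' & R3' & R4' & _).
    assert (M : d2 \o p1 = d1 \o p2) by apply (proj1 (kp_pullback K)).
    exists r, r'. repeat split; [apply Eq_jointly_monic; congruence ..|].
    apply (pullback_jointly_monic (kp_pullback K)); apply Eq_jointly_monic;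
      rewrite comp_idr, (comp_assoc _ r'), (comp_assoc _ (_ \o r')),
        ?R1', ?R2', ?R3', ?R4', <- comp_assoc; congruence. }
  destruct rotations as (r & r' & Hr & Hr' & Hrr).
  destruct (@goursat_kernel_lift _ _ _ _ p1 s2 (fmap T p1) (fmap T s2) (eta P2) (eta P1)
    S21 (eq_sym (eta_natural _)) (eq_sym (eta_natural _)) (eta_regular_epi P2)
    Z (fmap T r \o h) k) as (Z' & e & h' & k' & He & Eh & Ek & E1).
  { rewrite comp_assoc, <- fmap_comp, Hr. exact Ehk. }
  exists Z', e, (r' \o h'), k'. split; [exact He|]. split; [|split].
  - rewrite eta_at, Eh, !comp_assoc, <- fmap_comp, Hrr, fmap_id, comp_idl. reflexivity.
  - exact Ek.
  - rewrite (comp_eq1_at _ Hr'). exact E1.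
Qed.

(** The hypotheses say that [h], [k], [l], [n] witness the composites uv, vw,
    (uv)w and u(vw). On a cover, [h] and [k] come from (a,b,c) and (b,c,d); by
    uniqueness [l] and [n] then come from (a,c,d) and (a,b,d), which have the
    same composite (a,d). *)
Lemma quotient_associative (Z : C) (h k l n : Hom Z (T P2)) :
  fmap T p2 \o h = fmap T p1 \o k ->
  fmap T p1 \o l = fmap T m \o h -> fmap T p2 \o l = fmap T p2 \o k ->
  fmap T p1 \o n = fmap T p1 \o h -> fmap T p2 \o n = fmap T m \o k ->
  fmap T m \o l = fmap T m \o n.
Proof.
  intros Ehk L1 L2 N1 N2.
  destruct (quotient_triple_lift Ehk) as (Z' & e & h' & k' & He & Eh & Ek & E).
  destruct (@pullback_lift _ _ _ _ _ _ _ _ _ _ (m \o h') (p2 \o k') (kp_pullback K))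
    as (l' & L1' & L2').
  { rewrite d2m_at, E. apply d2p1_at. }
  destruct (@pullback_lift _ _ _ _ _ _ _ _ _ _ (p1 \o h') (m \o k') (kp_pullback K))
    as (n' & N1' & N2').
  { rewrite d1m_at, <- E. apply d2p1_at. }
  assert (El : l \o e = eta P2 \o l').
  { apply quotient_pair_jointly_monic; rewrite <- eta_at, ?L1', ?L2', eta_at, ?Eh, ?Ek,
      !comp_assoc, ?L1, ?L2; reflexivity. }
  assert (En : n \o e = eta P2 \o n').
  { apply quotient_pair_jointly_monic; rewrite <- eta_at, ?N1', ?N2', eta_at, ?Eh, ?Ek,
      !comp_assoc, ?N1, ?N2; reflexivity. }
  apply (regular_epi_epi He).
  rewrite <- !comp_assoc, El, En, <- !eta_at. f_equal.
  apply Eq_jointly_monic.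
  - rewrite !d1m_at, L1', N1', d1m_at. reflexivity.
  - rewrite !d2m_at, L2', N2', d2m_at. reflexivity.
Qed.

(** A functor that is a regular quotient of the identity preserves the
    groupoid of a kernel pair, although it need not preserve pullbacks. *)
Theorem quotient_of_kernel_pair_groupoid :
  is_internal_groupoid (map_precategory T (kernel_pair_precategory K)).
Proof.
  split; simpl.
  - split; [apply fmap_square, (proj1 (kp_pullback K))|].
    intros Z u v Euv. destruct (quotient_pair_exists Euv) as (h & H1 & H2).
    exists h. split; [auto|]. intros h' [H1' H2'].
    apply quotient_pair_jointly_monic; congruence.
  - intros Z u v w uv vw x y (h & H1 & H2 & H3) (l & L1 & L2 & L3)
      (k & K1 & K2 & K3) (n & N1 & N2 & N3). simpl in *.
    rewrite <- L3, <- N3. apply (@quotient_associative Z h k); congruence.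
  - destruct degeneracies as (s1 & _ & (S1 & S2 & S3) & _).
    exists (fmap T s1). simpl. rewrite <- !fmap_comp, S1, S2, S3, fmap_id. auto.
  - destruct degeneracies as (_ & s2 & _ & (S1 & S2 & S3)).
    exists (fmap T s2). simpl. rewrite <- !fmap_comp, S1, S2, S3, fmap_id. auto.
  - destruct inversion as (i & I1 & I2 & II & t & T1 & T2 & T3).
    exists (fmap T i). rewrite <- !fmap_comp, I1, I2. repeat split.
    + exists (fmap T t). simpl. rewrite <- !fmap_comp, T1, T2, T3, fmap_id. auto.
    (* [t i] is (a,b) |-> (b,a,b) *)
    + exists (fmap T (t \o i)). simpl.
      rewrite <- !fmap_comp, !comp_assoc, T1, T2, T3, comp_idl, II, <- comp_assoc, I1,
        fmap_id. auto.
Qed.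

End Quotient.
End Goursat.

(** * The reflection *)

Definition comp_functor (C D E : Category) (G : Functor D E) (F : Functor C D) :
    Functor C E.
Proof.
  refine (@Build_Functor C E (fun A => G (F A)) (fun A B f => fmap G (fmap F f)) _ _).
  - intro A. rewrite !fmap_id. reflexivity.
  - intros A B D' g f. rewrite !fmap_comp. reflexivity.
Defined.

Lemma groupoid_in_full_subcategory (C : Category) (X : C -> Prop)
    (P : Precategory (full_subcategory X)) :
  is_internal_groupoid (map_precategory (full_inclusion X) P) ->
  is_internal_groupoid P.
Proof.
  intros [[E U] assoc ul ur inv]. split.
  - split; [exact E|]. intro Z. exact (U (proj1_sig Z)).
  - intro Z. exact (assoc (proj1_sig Z)).
  - exact ul.
  - exact ur.
  - exact inv.
Qed.

Theorem corollary2p3 (C : Category) (C_goursat : is_goursat C)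
    (X : C -> Prop) (I : Functor C (full_subcategory X))
    (adj : Adjunction I (full_inclusion X))
    (X_reflective : is_regular_epi_reflective adj)
    (A B : C) (f : Hom A B) (f_extension : is_regular_epi f)
    (K : KernelPairData f) :
  is_internal_groupoid (Gal I K).
Proof.
  apply groupoid_in_full_subcategory.
  destruct (quotient_of_kernel_pair_groupoid C_goursat
    (T := comp_functor (full_inclusion X) I) (eta := adj_unit adj)
    (adj_unit_natural adj) X_reflective K) as [pb assoc ul ur inv].
  split; assumption.
Qed.
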